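(* (Soundness of $\mathbf{Tm}^*$.) Let $\Theta$ be a first-order signature and let $\Gamma\cup\{\alpha\}\subseteq For(\Theta)$ be a set of formulas. If $\Gamma\vdash_{\mathbf{Tm}^*}\alpha$, then $\Gamma\models_{\mathbf{Tm}^*}\alpha$.
   Context: SYNTAX. A first-order signature $\Theta$ consists of a nonempty set of predicate symbols, each of arity $\geq 1$, among which there is a binary symbol $\approx$ (identity); a possibly empty set of function symbols, each of arity $\geq 1$; and a possibly empty set of individual constants. $Var=\{x_1,x_2,\ldots\}$ is a fixed denumerable set of variables. Terms are defined as usual. The set $For(\Theta)$ of formulas is generated from atomic formulas $P\tau_1\ldots\tau_n$ (in particular $(\tau_1\approx\tau_2)$) by $\neg\alpha$, $\Box\alpha$, $\forall x\alpha$ and $\alpha\to\beta$. Abbreviations: $\Diamond\alpha:=\neg\Box\neg\alpha$, $\alpha\vee\beta:=\neg\alpha\to\beta$, $\alpha\wedge\beta:=\neg(\alpha\to\neg\beta)$, $\exists x\alpha:=\neg\forall x\neg\alpha$. Free and bound occurrences and ''term free for a variable in a formula'' are as usual. $\alpha[x/\tau]$ is the result of simultaneously replacing every free occurrence of $x$ in $\alpha$ by $\tau$. If $y$ is a variable free for $x$ in $\alpha$, $\alpha[x\wr y]$ denotes any formula obtained from $\alpha$ by replacing some (not necessarily all, maybe none) free occurrences of $x$ by $y$. Two formulas are variants of each other if one is obtained from the other by adding or deleting void quantifiers (quantifiers $\forall x\alpha$ with $x$ not free in $\alpha$) or by renaming bound variables (keeping the same free variables in the same places). HILBERT CALCULUS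 $\mathbf{Tm}^*$. Axiom schemas: (Ax1) $\alpha\to(\beta\to\alpha)$; (Ax2) $(\alpha\to(\beta\to\gamma))\to((\alpha\to\beta)\to(\alpha\to\gamma))$; (Ax3) $(\neg\beta\to\neg\alpha)\to((\neg\beta\to\alpha)\to\beta)$; (Ax4) $\forall x\alpha\to\alpha[x/\tau]$ if $\tau$ is free for $x$ in $\alpha$; (Ax5) $\forall x(\alpha\to\beta)\to(\alpha\to\forall x\beta)$ if $x$ is not free in $\alpha$; (Ax6) $\alpha\to\beta$ if $\alpha$ is a variant of $\beta$; (Ax7) $\forall x(x\approx x)$; (Ax8) $(x\approx y)\to(\alpha\to\alpha[x\wr y])$ if $y$ is a variable free for $x$ in $\alpha$; (N=) $(x\approx y)\to\Box(x\approx y)$; (P=) $\neg(x\approx y)\to\Box\neg(x\approx y)$; (K) $\Box(\alpha\to\beta)\to(\Box\alpha\to\Box\beta)$; (K1) $\Box(\alpha\to\beta)\to(\Diamond\alpha\to\Diamond\beta)$; (K2) $\Diamond(\alpha\to\beta)\to(\Box\alpha\to\Diamond\beta)$; (M1) $\Box\neg\alpha\to\Box(\alpha\to\beta)$; (M2) $\Box\beta\to\Box(\alpha\to\beta)$; (M3) $\Diamond\beta\to\Diamond(\alpha\to\beta)$; (M4) $\Diamond\neg\alpha\to\Diamond(\alpha\to\beta)$; (T) $\Box\alpha\to\alpha$; (DN1) $\Box\alpha\to\Box\neg\neg\alpha$; (DN2) $\Box\neg\neg\alpha\to\Box\alpha$; (BF) $\forall x\Box\alpha\to\Box\forall x\alpha$;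 (CBF) $\Box\forall x\alpha\to\forall x\Box\alpha$; (NBF) $\forall x\Diamond\alpha\to\Diamond\forall x\alpha$; (PBF) $\Diamond\forall x\alpha\to\forall x\Diamond\alpha$. Rules: (MP) from $\alpha$ and $\alpha\to\beta$ infer $\beta$; (Gen) from $\alpha$ infer $\forall x\alpha$. $\Gamma\vdash_{\mathbf{Tm}^*}\alpha$ means there is a finite sequence ending in $\alpha$, each member of which is an element of $\Gamma$, an axiom instance, or follows from earlier members by (MP) or (Gen) (the usual notion of derivation from premises in Hilbert calculi; (Gen) may be applied to premises). TRUTH VALUES. $V_4=\{T^+,C^+,C^-,F^-\}$, with designated values $T^+,C^+$. Multioperations: $\tilde\neg T^+=\{F^-\}$, $\tilde\neg C^+=\{C^-\}$, $\tilde\neg C^-=\{C^+\}$, $\tilde\neg F^-=\{T^+\}$; $\tilde\Box T^+=\{T^+,C^+\}$ and $\tilde\Box C^+=\tilde\Box C^-=\tilde\Box F^-=\{C^-,F^-\}$; the values $a\,\tilde\to\,b$ for $b=T^+,C^+,C^-,F^-$ in this order are: for $a=T^+$: $\{T^+\},\{C^+\},\{C^-\},\{F^-\}$; for $a=C^+$: $\{T^+\},\{T^+,C^+\},\{C^-\},\{C^-\}$; for $a=C^-$: $\{T^+\},\{T^+,C^+\},\{T^+,C^+\},\{C^+\}$; for $a=F^-$: $\{T^+\},\{T^+\},\{T^+\},\{T^+\}$. For $\emptyset\neq X\subseteq V_4$, $\tilde\forall_4^d(X)=\{\min X\}$ with respect to the chain $F^-\leq C^-\leq C^+\leq T^+$.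 SEMANTICS. A first-order structure for $\mathbf{Tm}^*$ is $\mathfrak A=\langle U,\cdot^{\mathfrak A}\rangle$ with $U\neq\emptyset$, where each $n$-ary predicate $P$ is interpreted as a pair $(\mathfrak a^{\mathfrak A}(P),\mathfrak c^{\mathfrak A}(P))$ of subsets of $U^n$, with $\mathfrak a^{\mathfrak A}(\approx)=\{(a,a):a\in U\}$ and $\mathfrak c^{\mathfrak A}(\approx)=\emptyset$; constants are interpreted as elements of $U$, and $n$-ary function symbols as functions $U^n\to U$. An assignment is a function $s:Var\to U$; $\mathsf A(\mathfrak A)$ is the set of assignments; $\mathsf E_x(s)$ is the set of assignments agreeing with $s$ on all variables other than $x$; $s^x_a\in\mathsf E_x(s)$ is the one with $s^x_a(x)=a$. The denotation $[\![\tau]\!]^{\mathfrak A}_s\in U$ of a term is defined as usual. A valuation over $\mathfrak A$ is a function $v:For(\Theta)\times\mathsf A(\mathfrak A)\to V_4$ such that, for all $s$: 1. with $\vec u=([\![\tau_1]\!]^{\mathfrak A}_s,\ldots,[\![\tau_n]\!]^{\mathfrak A}_s)$, $v(P\tau_1\ldots\tau_n,s)$ is $T^+$ iff $\vec u\in\mathfrak a^{\mathfrak A}(P)\setminus\mathfrak c^{\mathfrak A}(P)$; $C^+$ iff $\vec u\in\mathfrak a^{\mathfrak A}(P)\cap\mathfrak c^{\mathfrak A}(P)$; $C^-$ iff $\vec u\in\mathfrak c^{\mathfrak A}(P)\setminus\mathfrak a^{\mathfrak A}(P)$; $F^-$ iff $\vec u\in U^n\setminus(\mathfrak a^{\mathfrak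 A}(P)\cup\mathfrak c^{\mathfrak A}(P))$; 2. $v((\tau_1\approx\tau_2),s)=T^+$ iff $[\![\tau_1]\!]^{\mathfrak A}_s=[\![\tau_2]\!]^{\mathfrak A}_s$, and $=F^-$ iff $[\![\tau_1]\!]^{\mathfrak A}_s\neq[\![\tau_2]\!]^{\mathfrak A}_s$; 3. $v(\#\alpha,s)\in\tilde\#\,v(\alpha,s)$ for $\#\in\{\neg,\Box\}$; 4. $v(\alpha\to\beta,s)\in v(\alpha,s)\,\tilde\to\,v(\beta,s)$; 5. $v(\forall x\alpha,s)\in\tilde\forall_4^d(\{v(\alpha,s'):s'\in\mathsf E_x(s)\})$; 6. if $\tau$ is free for $z$ in $\varphi$ and $b=[\![\tau]\!]^{\mathfrak A}_s$, then $v(\varphi[z/\tau],s)=v(\varphi,s^z_b)$; 7. if $\varphi,\varphi'$ are variants, then $v(\varphi,s)=v(\varphi',s)$; 8. if $y$ is a variable free for $x$ in $\varphi$, then $v((x\approx y)\to(\varphi\to\varphi[x\wr y]),s)\in\{T^+,C^+\}$. A formula $\alpha$ is true in $(\mathfrak A,v)$ if $v(\alpha,s)\in\{T^+,C^+\}$ for every assignment $s$. $\Gamma\models_{\mathbf{Tm}^*}\alpha$ means: for every structure $\mathfrak A$ and every valuation $v$ over $\mathfrak A$, if every $\gamma\in\Gamma$ is true in $(\mathfrak A,v)$ then $\alpha$ is true in $(\mathfrak A,v)$. *)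

(* Defs.v *)
From mathcomp Require Import all_boot.
From mathcomp Require Import boolp classical_sets.

Set Implicit Arguments.
Unset Strict Implicit.
Unset Printing Implicit Defensive.

Local Open Scope classical_set_scope.

Record signature := Signature {
  predsym : Type;
  predar : predsym -> nat;
  predar_gt0 : forall P, 0 < predar P;
  eqsym : predsym;
  eqsym_ar : predar eqsym = 2;
  funsym : Type;
  funar : funsym -> nat;
  funar_gt0 : forall f, 0 < funar f;
  cstsym : Type }.

Definition var := nat.

(* T ^ n is {ffun 'I_n -> T}, the type of n-tuples over T. *)
Inductive term (S : signature) : Type :=
| Var of var
| Cst of cstsym S
| App (f : funsym S) of term S ^ funar f.

Inductive formula (S : signature) : Type :=
| Atom (P : predsym S) of term S ^ predar P
| Neg of formula S
| Box of formula S
| All of var & formula S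
| Imp of formula S & formula S.

Arguments Var {S}.
Arguments Cst {S}.
Arguments App {S}.
Arguments Atom {S}.

Infix "~>" := Imp (at level 60, right associativity).

(* The pair (a, b); since the index type is 'I_n for an arbitrary n, it can be
   used at n = predar (eqsym S), which is only provably equal to 2. *)
Definition pair2 (T : Type) (n : nat) (a b : T) : T ^ n :=
  [ffun i : 'I_n => if i == 0 :> nat then a else b].

Definition Eqn (S : signature) (t1 t2 : term S) : formula S :=
  Atom (eqsym S) (pair2 _ t1 t2).

Definition Dia (S : signature) (a : formula S) : formula S := Neg (Box (Neg a)).

Fixpoint occurs (S : signature) (x : var) (t : term S) : bool :=
  match t with
  | Var y => y == x
  | Cst _ => false
  | App _ ts => [exists i, occurs x (ts i)]
  end.

Fixpoint free (S : signature) (x : var) (a : formula S) : bool :=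
  match a with
  | Atom _ ts => [exists i, occurs x (ts i)]
  | Neg b | Box b => free x b
  | All y b => (y != x) && free x b
  | b ~> c => free x b || free x c
  end.

Fixpoint tsubst (S : signature) (x : var) (u t : term S) : term S :=
  match t with
  | Var y => if y == x then u else Var y
  | Cst c => Cst c
  | App f ts => App f [ffun i => tsubst x u (ts i)]
  end.

(* No renaming of bound variables takes place: subst x u a replaces exactly
   the free occurrences of x in a, even if this captures variables of u. *)
Fixpoint subst (S : signature) (x : var) (u : term S) (a : formula S) : formula S :=
  match a with
  | Atom P ts => Atom P [ffun i => tsubst x u (ts i)]
  | Neg b => Neg (subst x u b)
  | Box b => Box (subst x u b)
  | All y b => if y == x then All y b else All y (subst x u b)
  | b ~> c => subst x u b ~> subst x u c
  end.

(* u is free for x in a: no free occurrence of x in a lies within the scope of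
   a quantifier binding a variable of u. *)
Fixpoint free_for (S : signature) (u : term S) (x : var) (a : formula S) : bool :=
  match a with
  | Atom _ _ => true
  | Neg b | Box b => free_for u x b
  | All y b => ~~ free x (All y b) || ~~ occurs y u && free_for u x b
  | b ~> c => free_for u x b && free_for u x c
  end.

(* some_subst x y a b: b is one of the formulas obtained from a by replacing
   some, possibly none, of the free occurrences of x by y. *)
Inductive some_tsubst (S : signature) (x y : var) : term S -> term S -> Prop :=
| STrefl t : some_tsubst x y t t
| STvar : some_tsubst x y (Var x) (Var y)
| STapp f (ts us : term S ^ funar f) :
    (forall i, some_tsubst x y (ts i) (us i)) ->
    some_tsubst x y (App f ts) (App f us).

Inductive some_subst (S : signature) (x y : var) : formula S -> formula S -> Prop :=
| SSrefl a : some_subst x y a a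
| SSatom P (ts us : term S ^ predar P) :
    (forall i, some_tsubst x y (ts i) (us i)) ->
    some_subst x y (Atom P ts) (Atom P us)
| SSneg a b : some_subst x y a b -> some_subst x y (Neg a) (Neg b)
| SSbox a b : some_subst x y a b -> some_subst x y (Box a) (Box b)
| SSall z a b : z != x -> some_subst x y a b -> some_subst x y (All z a) (All z b)
| SSimp a b c d : some_subst x y a b -> some_subst x y c d ->
    some_subst x y (a ~> c) (b ~> d).

(* Additions or deletions of void quantifiers and renamings of bound variables,
   at any position in the formula and any number of times. *)
Inductive variant (S : signature) : formula S -> formula S -> Prop :=
| Vvoid x a : ~~ free x a -> variant (All x a) a
| Vrename x y a : ~~ free y a -> free_for (Var y) x a ->
    variant (All x a) (All y (subst x (Var y) a))
| Vneg a b : variant a b -> variant (Neg a) (Neg b)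
| Vbox a b : variant a b -> variant (Box a) (Box b)
| Vall x a b : variant a b -> variant (All x a) (All x b)
| Vimp a b c d : variant a b -> variant c d -> variant (a ~> c) (b ~> d)
| Vrefl a : variant a a
| Vsym a b : variant a b -> variant b a
| Vtrans a b c : variant a b -> variant b c -> variant a c.

Inductive tm_axiom (S : signature) : formula S -> Prop :=
| Ax1 a b : tm_axiom (a ~> (b ~> a))
| Ax2 a b c : tm_axiom ((a ~> (b ~> c)) ~> ((a ~> b) ~> (a ~> c)))
| Ax3 a b : tm_axiom ((Neg b ~> Neg a) ~> ((Neg b ~> a) ~> b))
| Ax4 x t a : free_for t x a -> tm_axiom (All x a ~> subst x t a)
| Ax5 x a b : ~~ free x a -> tm_axiom (All x (a ~> b) ~> (a ~> All x b))
| Ax6 a b : variant a b -> tm_axiom (a ~> b)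
| Ax7 x : tm_axiom (All x (Eqn (Var x) (Var x)))
| Ax8 x y a b : free_for (Var y) x a -> some_subst x y a b ->
    tm_axiom (Eqn (Var x) (Var y) ~> (a ~> b))
| AxNeq x y : tm_axiom (Eqn (Var x) (Var y) ~> Box (Eqn (Var x) (Var y)))
| AxPeq x y : tm_axiom (Neg (Eqn (Var x) (Var y)) ~> Box (Neg (Eqn (Var x) (Var y))))
| AxK a b : tm_axiom (Box (a ~> b) ~> (Box a ~> Box b))
| AxK1 a b : tm_axiom (Box (a ~> b) ~> (Dia a ~> Dia b))
| AxK2 a b : tm_axiom (Dia (a ~> b) ~> (Box a ~> Dia b))
| AxM1 a b : tm_axiom (Box (Neg a) ~> Box (a ~> b))
| AxM2 a b : tm_axiom (Box b ~> Box (a ~> b))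
| AxM3 a b : tm_axiom (Dia b ~> Dia (a ~> b))
| AxM4 a b : tm_axiom (Dia (Neg a) ~> Dia (a ~> b))
| AxT a : tm_axiom (Box a ~> a)
| AxDN1 a : tm_axiom (Box a ~> Box (Neg (Neg a)))
| AxDN2 a : tm_axiom (Box (Neg (Neg a)) ~> Box a)
| AxBF x a : tm_axiom (All x (Box a) ~> Box (All x a))
| AxCBF x a : tm_axiom (Box (All x a) ~> All x (Box a))
| AxNBF x a : tm_axiom (All x (Dia a) ~> Dia (All x a))
| AxPBF x a : tm_axiom (Dia (All x a) ~> All x (Dia a)).

(* d 0, ..., d n is a derivation from the premises G. *)
Definition derivation (S : signature) (G : set (formula S)) (n : nat)
    (d : 'I_n.+1 -> formula S) : Prop :=
  forall i, [\/ G (d i),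
                tm_axiom (d i),
                exists j k : 'I_n.+1, [/\ j < i, k < i & d k = (d j ~> d i)]
              | exists (j : 'I_n.+1) x, j < i /\ d i = All x (d j)].

Definition derivable (S : signature) (G : set (formula S)) (a : formula S) : Prop :=
  exists n (d : 'I_n.+1 -> formula S), derivation G d /\ d ord_max = a.

Inductive V4 := Tp | Cp | Cm | Fm.

Definition designated : set V4 := [set Tp; Cp].

Definition neg4 (a : V4) : set V4 :=
  match a with
  | Tp => [set Fm]
  | Cp => [set Cm]
  | Cm => [set Cp]
  | Fm => [set Tp]
  end.

Definition box4 (a : V4) : set V4 :=
  match a with
  | Tp => [set Tp; Cp]
  | Cp | Cm | Fm => [set Cm; Fm]
  end.

Definition imp4 (a b : V4) : set V4 :=
  match a, b with
  | Tp, Tp => [set Tp]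
  | Tp, Cp => [set Cp]
  | Tp, Cm => [set Cm]
  | Tp, Fm => [set Fm]
  | Cp, Tp => [set Tp]
  | Cp, Cp => [set Tp; Cp]
  | Cp, Cm => [set Cm]
  | Cp, Fm => [set Cm]
  | Cm, Tp => [set Tp]
  | Cm, Cp => [set Tp; Cp]
  | Cm, Cm => [set Tp; Cp]
  | Cm, Fm => [set Cp]
  | Fm, _ => [set Tp]
  end.

Definition rank4 (a : V4) : nat :=
  match a with Fm => 0 | Cm => 1 | Cp => 2 | Tp => 3 end.

(* The singleton {min X}, for X nonempty. *)
Definition forall4 (X : set V4) : set V4 :=
  [set m | X m /\ forall a, X a -> rank4 m <= rank4 a].

Record structure (S : signature) := Structure {
  carrier : Type;
  carrier_inhabited : inhabited carrier;
  apred : forall P : predsym S, set (carrier ^ predar P);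
  cpred : forall P : predsym S, set (carrier ^ predar P);
  apred_eq : @apred (eqsym S) = [set pair2 _ a a | a in [set: carrier]];
  cpred_eq : @cpred (eqsym S) = set0;
  ifun : forall f : funsym S, carrier ^ funar f -> carrier;
  icst : cstsym S -> carrier }.

Arguments apred {S}.
Arguments cpred {S}.

Definition assignment (S : signature) (A : structure S) := var -> carrier A.

Definition agree_off (S : signature) (A : structure S) (x : var)
    (s : assignment A) : set (assignment A) :=
  [set s' | forall y, y <> x -> s' y = s y].

Definition update (S : signature) (A : structure S) (s : assignment A)
    (x : var) (a : carrier A) : assignment A :=
  fun y => if y == x then a else s y.

Fixpoint den (S : signature) (A : structure S) (s : assignment A) (t : term S) :
    carrier A :=
  match t with
  | Var x => s x
  | Cst c => icst A c
  | App f ts => ifun [ffun i => den s (ts i)]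
  end.

Record valuation (S : signature) (A : structure S)
    (v : formula S -> assignment A -> V4) : Prop := Valuation {
  val_atom : forall P (ts : term S ^ predar P) s,
    let u := [ffun i => den s (ts i)] in
    [/\ v (Atom P ts) s = Tp <-> (apred A P `\` cpred A P) u,
        v (Atom P ts) s = Cp <-> (apred A P `&` cpred A P) u,
        v (Atom P ts) s = Cm <-> (cpred A P `\` apred A P) u
      & v (Atom P ts) s = Fm <-> (~` (apred A P `|` cpred A P)) u];
  val_eq : forall t1 t2 s,
    (v (Eqn t1 t2) s = Tp <-> den s t1 = den s t2) /\
    (v (Eqn t1 t2) s = Fm <-> den s t1 <> den s t2);
  val_neg : forall a s, neg4 (v a s) (v (Neg a) s);
  val_box : forall a s, box4 (v a s) (v (Box a) s);
  val_imp : forall a b s, imp4 (v a s) (v b s) (v (a ~> b) s);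
  val_all : forall x a s,
    forall4 [set v a s' | s' in agree_off x s] (v (All x a) s);
  val_subst : forall a z t s, free_for t z a ->
    v (subst z t a) s = v a (update s z (den s t));
  val_variant : forall a b s, variant a b -> v a s = v b s;
  val_leibniz : forall x y a b s,
    free_for (Var y) x a -> some_subst x y a b ->
    designated (v (Eqn (Var x) (Var y) ~> (a ~> b)) s) }.

Definition true_in (S : signature) (A : structure S)
    (v : formula S -> assignment A -> V4) (a : formula S) : Prop :=
  forall s, designated (v a s).

Definition entails (S : signature) (G : set (formula S)) (a : formula S) : Prop :=
  forall (A : structure S) (v : formula S -> assignment A -> V4),
    valuation v -> (forall g, G g -> true_in v g) -> true_in v a.

(* Main.v *)
Require Import Defs.
From mathcomp Require Import all_boot.
From mathcomp Require Import boolp classical_sets.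
From mathcomp Require Import zify.

(** Soundness is proved by induction along the derivation: axioms are true
    under every valuation, and both rules preserve truth.

    Although the connectives are multivalued, everything the axioms assert
    depends only on the position of truth values in the chain
    [Fm < Cm < Cp < Tp], where [rank4] takes the values 0, 1, 2, 3. A formula [a]
    is designated when the rank of [a] is at least 2, [Box a] when the rank of
    [a] is at least 3, and [Dia a] when the rank of [a] is at least 1
    ([designated_rank], [designated_box], [designated_dia]); the choice that
    the multioperation of [Box] leaves open never matters. In these terms:

    - negation is the order-reversing involution, and designation of an
      implication is classical ([rank_neg], [designated_imp]). This gives the
      propositional axioms, modus ponens and the double negation axioms;
    - an implication is at least as true as its conclusion and as the negation
      of its premise ([rank_imp_ge], axioms (M1)-(M4)); if its rank is 3, its
      premise is not above its conclusion ([rank_imp_le], axioms (K), (K1)); if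
      its premise has rank 3, it has the value of its conclusion ([imp_top],
      axiom (K2));
    - a universal formula is a minimum, so it reaches a rank exactly when all
      its instances do ([rank_all]). Ranks 1 and 3 give the four Barcan axioms,
      and rank 2 gives the quantifier axioms and generalization.

    What remains is nearly built into the notion of valuation: it respects
    substitution, variants and the Leibniz rule by definition, invariance under
    variants makes the value of a formula insensitive to changing a variable
    that is not free in it ([val_not_free], for (Ax5)), and identities take only
    extreme values ([designated_eq], [designated_neq], for (N=) and (P=)). *)

Set Implicit Arguments.
Unset Strict Implicit.
Unset Printing Implicit Defensive.

Local Open Scope classical_set_scope.

Lemma designated_rank (a : V4) : designated a <-> 1 < rank4 a.
Proof.
by case: a; split => //=; [left | right | case | case].
Qed.

Lemma rank4_le3 (a : V4) : rank4 a <= 3.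
Proof. by case: a. Qed.

Lemma rank4_inj : injective rank4.
Proof. by case; case. Qed.

Lemma imp4_designated (a b c : V4) : imp4 a b c ->
  (designated c <-> (designated a -> designated b)).
Proof.
by rewrite !designated_rank; case: a; case: b => /=;
  first [move=> -> | case=> ->] => /=;
  split => //; apply.
Qed.

Lemma imp4_ge (a b c : V4) : imp4 a b c ->
  3 - rank4 a <= rank4 c /\ rank4 b <= rank4 c.
Proof. by case: a; case: b => /=; first [move=> -> | case=> ->]. Qed.

Lemma imp4_le (a b c : V4) : imp4 a b c -> 2 < rank4 c -> rank4 a <= rank4 b.
Proof. by case: a; case: b => /=; first [move=> -> | case=> ->]. Qed.

Lemma imp4_top (a b c : V4) : imp4 a b c -> 2 < rank4 a -> c = b.
Proof. by case: a; case: b. Qed.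

Section Valuation.

Variables (S : signature) (A : structure S) (v : formula S -> assignment A -> V4).
Hypothesis hv : valuation v.

Implicit Types (a b c : formula S) (s : assignment A) (x y : var).

Lemma rank_neg a s : rank4 (v (Neg a) s) = 3 - rank4 (v a s).
Proof. by have := val_neg hv a s; case: (v a s) => /= ->. Qed.

Lemma designated_neg a s : designated (v (Neg a) s) <-> ~ designated (v a s).
Proof.
rewrite !designated_rank rank_neg.
by split; [lia | move=> /negP; lia].
Qed.

Lemma designated_imp a b s :
  designated (v (a ~> b) s) <-> (designated (v a s) -> designated (v b s)).
Proof. exact: imp4_designated (val_imp hv a b s). Qed.

Lemma designated_box a s : designated (v (Box a) s) <-> 2 < rank4 (v a s).
Proof.
rewrite designated_rank; have := val_box hv a s.
by case: (v a s) => /= -[] ->.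
Qed.

Lemma designated_dia a s : designated (v (Dia a) s) <-> 0 < rank4 (v a s).
Proof.
rewrite designated_neg designated_box rank_neg.
by split; [move=> /negP; lia | lia].
Qed.

Lemma rank_imp_ge a b s :
  3 - rank4 (v a s) <= rank4 (v (a ~> b) s) /\
  rank4 (v b s) <= rank4 (v (a ~> b) s).
Proof. exact: imp4_ge (val_imp hv a b s). Qed.

Lemma rank_imp_le a b s :
  2 < rank4 (v (a ~> b) s) -> rank4 (v a s) <= rank4 (v b s).
Proof. exact: imp4_le (val_imp hv a b s). Qed.

Lemma imp_top a b s : 2 < rank4 (v a s) -> v (a ~> b) s = v b s.
Proof. exact: imp4_top (val_imp hv a b s). Qed.

(** The left-to-right direction uses that the minimum is a lower bound, the
    converse that it is attained. *)
Lemma rank_all n x a s :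
  n < rank4 (v (All x a) s) <-> forall s', agree_off x s s' -> n < rank4 (v a s').
Proof.
have [[s0 s0P <-] min_s0] := val_all hv x a s.
split=> [n_lt s' s'P | ]; last exact.
by apply: leq_trans n_lt _; apply: min_s0; exists s'.
Qed.

Lemma designated_all x a s :
  designated (v (All x a) s) <->
  forall s', agree_off x s s' -> designated (v a s').
Proof.
rewrite designated_rank rank_all.
by split=> H s' /H; rewrite designated_rank.
Qed.

Lemma agree_off_sym x s s' : agree_off x s s' -> agree_off x s' s.
Proof. by move=> ss' y /ss'. Qed.

Lemma agree_off_update x s u : agree_off x s (update s x u).
Proof. by move=> y /eqP /negbTE yx; rewrite /update yx. Qed.

(** No induction on the formula would work here, since the value of a compound
    formula is not determined by the values of its parts. Instead, a void
    quantifier leaves the value unchanged, so the value at [s] is the minimum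
    over all assignments that differ from [s] at [x] only. *)
Lemma val_not_free x a s s' :
  ~~ free x a -> agree_off x s s' -> v a s = v a s'.
Proof.
move=> xa; suff le t t' : agree_off x t t' -> rank4 (v a t) <= rank4 (v a t').
  by move=> ss'; apply/rank4_inj/eqP; rewrite eqn_leq !le //; apply: agree_off_sym.
move=> tt'; rewrite -(val_variant hv t (Vvoid xa)).
by have [_ min_t] := val_all hv x a t; apply: min_t; exists t'.
Qed.

(** Identities take only the extreme values, because the second component of
    the interpretation of identity is empty; this is why they, and their
    negations, are necessary as soon as they are true. *)
Lemma designated_eq t1 t2 s :
  designated (v (Eqn t1 t2) s) -> 2 < rank4 (v (Eqn t1 t2) s).
Proof.
rewrite designated_rank; have [[_ eqT] [_ neqF]] := val_eq hv t1 t2 s.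
by have [/eqT -> | /neqF ->] := pselect (den s t1 = den s t2).
Qed.

Lemma designated_neq t1 t2 s :
  designated (v (Neg (Eqn t1 t2)) s) -> 2 < rank4 (v (Neg (Eqn t1 t2)) s).
Proof.
rewrite designated_rank rank_neg; have [[_ eqT] [_ neqF]] := val_eq hv t1 t2 s.
by have [/eqT -> | /neqF ->] := pselect (den s t1 = den s t2).
Qed.

Lemma axiom_true a : tm_axiom a -> true_in v a.
Proof.
case=> {a}.
- by move=> a b s; rewrite !designated_imp.
- by move=> a b c s; rewrite !designated_imp => abc ab /[dup] /ab /[swap] /abc.
- move=> a b s; rewrite !designated_imp !designated_neg => nba nb.
  by have [//|/[dup] /nba + /nb] := pselect (designated (v b s)).
- move=> x t a tx s; rewrite designated_imp designated_all (val_subst hv s tx).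
  by apply; apply: agree_off_update.
- move=> x a b xa s; rewrite !designated_imp !designated_all => ab as_ s' ss'.
  by have := ab s' ss'; rewrite designated_imp -(val_not_free xa ss'); apply.
- by move=> a b ab s; rewrite designated_imp (val_variant hv s ab).
- move=> x s; rewrite designated_all => s' _.
  by have [[_ ->]] := val_eq hv (Var x) (Var x) s'; first left.
- by move=> x y a b yx ab s; apply: val_leibniz.
- by move=> x y s; rewrite designated_imp designated_box; apply: designated_eq.
- by move=> x y s; rewrite designated_imp designated_box; apply: designated_neq.
- move=> a b s; rewrite !designated_imp !designated_box => /rank_imp_le ab as_.
  exact: leq_trans as_ ab.
- move=> a b s; rewrite !designated_imp designated_box !designated_dia.
  by move=> /rank_imp_le ab as_; exact: leq_trans as_ ab.
- move=> a b s; rewrite !designated_imp designated_box !designated_dia => ab.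
  by move=> /imp_top <-.
- move=> a b s; rewrite designated_imp !designated_box rank_neg => as_.
  by have [ge_a _] := rank_imp_ge a b s; exact: leq_trans as_ ge_a.
- move=> a b s; rewrite designated_imp !designated_box => bs.
  by have [_ ge_b] := rank_imp_ge a b s; exact: leq_trans bs ge_b.
- move=> a b s; rewrite designated_imp !designated_dia => bs.
  by have [_ ge_b] := rank_imp_ge a b s; exact: leq_trans bs ge_b.
- move=> a b s; rewrite designated_imp !designated_dia rank_neg => as_.
  by have [ge_a _] := rank_imp_ge a b s; exact: leq_trans as_ ge_a.
- by move=> a s; rewrite designated_imp designated_box designated_rank; apply: ltnW.
- by move=> a s; rewrite designated_imp !designated_box !rank_neg subKn ?rank4_le3.
- by move=> a s; rewrite designated_imp !designated_box !rank_neg subKn ?rank4_le3.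
- move=> x a s; rewrite designated_imp designated_box designated_all rank_all.
  by move=> H s' /H; rewrite designated_box.
- move=> x a s; rewrite designated_imp designated_box designated_all rank_all.
  by move=> H s' /H; rewrite designated_box.
- move=> x a s; rewrite designated_imp designated_dia designated_all rank_all.
  by move=> H s' /H; rewrite designated_dia.
- move=> x a s; rewrite designated_imp designated_dia designated_all rank_all.
  by move=> H s' /H; rewrite designated_dia.
Qed.

End Valuation.

Theorem theorem2p15 (S : signature) (G : set (formula S)) (a : formula S) :
  derivable G a -> entails G a.
Proof.
move=> [n [d [dP <-]]] A v hv GP.
suff dtrue k (i : 'I_n.+1) : i < k -> true_in v (d i) by exact: dtrue (ltn_ord _).
elim: k i => // k IH i; rewrite ltnS => ik.
case: (dP i) => [/GP // | /(axiom_true hv) // | [j [l [ji li dl]]] | [j [x [ji ->]]]].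
- move=> s; have := IH l (leq_trans li ik) s.
  by rewrite dl (designated_imp hv); apply; exact: IH (leq_trans ji ik) s.
- by move=> s; rewrite (designated_all hv) => s' _; exact: IH (leq_trans ji ik) s'.
Qed.
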